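(* Let $n\ge 2$ and $1\le k\le n$. Let $Y_0,Y_1,\dots,Y_{(n-1)^2}$ be a sequence of Young diagrams with $Y_0$ empty, $Y_{(n-1)^2}$ the full $(n-1)\times(n-1)$ square, and each $Y_m$ obtained from $Y_{m-1}$ by adding a single box. Then for each $m$, the collection $T_k(Y_m)$ consisting of the minors associated to the chambers of $D(Y_m)$ lying in tracks $1,\dots,k$, together with all solid $k$-minors of $X$ not already among them, has exactly $n^2$ elements and is a $k$-positivity test: a real $n\times n$ matrix $M$ is $k$-positive if and only if every minor in $T_k(Y_m)$, evaluated at $M$, is positive.
   Context: $X=(x_{ij})$ is an $n\times n$ matrix of indeterminates; $|X_{R,C}|$ is the minor with rows $R$, columns $C$. A solid $k$-minor is $|X_{[i,i+k-1],[j,j+k-1]}|$ with $[a,b]=\{a,\dots,b\}$. A real matrix is $k$-positive if all its minors of order at most $k$ are positive. Young diagrams are in English notation and fit in an $(n-1)\times(n-1)$ square. Double wiring diagrams as words: a word in letters $e_s,f_s$ ($1\le s\le n-1$). There are $n$ red and $n$ blue wires; at the left end red wires occupy heights $1,\dots,n$ (bottom to top) in the order $n,n-1,\dots,1$ and blue wires in the order $1,\dots,n$. Letter $e_s$ (red crossing in track $s$) swaps the red wires at heights $s,s+1$; $f_s$ (blue crossing in track $s$) swaps the blue wires at heights $s,s+1$. Track $t$ is the band between heights $t$ and $t+1$ (track $n$: above height $n$); its chambers are the maximal regions of the band not separated by letters $e_t,f_t$. A chamber of track $t$ with red wires $r$ and blue wires $b$ at heights $1,\dots,t$ has associated minor $|X_{r,b}|$.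 The diagram $D(Y)$: set $r_i=e_{n-i}\cdots e_1$ and $b_i=f_1\cdots f_{n-i}$ ($1\le i\le n-1$). With $\ell_i$ the number of boxes in row $i$ of $Y$, start with $b_1\cdots b_{n-1}$ and for each $i\in[n-1]$ insert $r_i$ between $b_{\ell_i}$ and $b_{\ell_i+1}$ (at the beginning if $\ell_i=0$, at the end if $\ell_i=n-1$); several $r_j$ in the same gap are arranged in decreasing order of $j$ left to right. *)

(* Defs.v *)
From mathcomp Require Import all_boot all_order all_algebra.
From mathcomp Require Import reals.

Set Implicit Arguments.
Unset Strict Implicit.
Unset Printing Implicit Defensive.

Import Order.TTheory GRing.Theory Num.Theory.

Local Open Scope ring_scope.

(* Conventions.  Wire labels, heights, tracks and rows of a Young diagram are
   natural numbers starting at 1, whereas the rows and columns of a matrix are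
   indexed by 'I_n: the ordinal x stands for the label x.+1. *)

(* The minor with rows I and columns J (both enumerated increasingly) is
   represented by the pair (I, J), where I and J have the same cardinality. *)
Notation minor_index n := ({set 'I_n} * {set 'I_n})%type.

(* The value of a minor at a matrix.  The default value of nth is never used
   when #|I| = #|J|. *)
Definition minor (R : comNzRingType) (n : nat) (M : 'M[R]_n)
    (IJ : minor_index n) : R :=
  \det (\matrix_(a < #|IJ.1|, b < #|IJ.1|)
          M (enum_val a) (nth (enum_val a) (enum IJ.2) b)).

Definition k_positive (R : realType) (n k : nat) (M : 'M[R]_n) : Prop :=
  forall I J : {set 'I_n},
    #|I| = #|J| -> (1 <= #|I| <= k)%N -> 0 < minor M (I, J).

(* With the 0-based indexing of 'I_n, this is the set of labels
   a + 1, ..., a + k. *)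
Definition interval (n k a : nat) : {set 'I_n} :=
  [set x : 'I_n | (a <= x < a + k)%N].

Definition solid_minors (n k : nat) : {set minor_index n} :=
  [set (interval n k i, interval n k j) |
     i : 'I_(n - k).+1, j : 'I_(n - k).+1].

(* Double wiring diagrams: red_cross s is e_s and blue_cross s is f_s. *)
Inductive letter := red_cross of nat | blue_cross of nat.

Definition track (l : letter) : nat :=
  match l with red_cross s => s | blue_cross s => s end.

(* A configuration of wires of one colour maps each height h (1 <= h <= n) to
   the label of the wire at height h. *)
Definition swap (s : nat) (w : nat -> nat) : nat -> nat :=
  fun h => if h == s then w s.+1 else if h == s.+1 then w s else w h.

(* The red and the blue configurations, in this order. *)
Definition wires := ((nat -> nat) * (nat -> nat))%type.

Definition cross (c : wires) (l : letter) : wires :=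
  match l with
  | red_cross s => (swap s c.1, c.2)
  | blue_cross s => (c.1, swap s c.2)
  end.

Definition left_end (n : nat) : wires := (fun h => n.+1 - h, fun h => h)%N.

(* The wires just after the first p letters of the word. *)
Definition wires_at (n : nat) (word : seq letter) (p : nat) : wires :=
  foldl cross (left_end n) (take p word).

Definition labels_upto (n t : nat) (w : nat -> nat) : {set 'I_n} :=
  [set x : 'I_n | x.+1 \in [seq w h | h <- iota 1 t]].

(* A chamber of track t is represented by the position of its left boundary:
   either the left end of the diagram (position 0), or the position right after
   a letter e_t or f_t. *)
Definition chambers (word : seq letter) (t : nat) : seq nat :=
  0%N :: [seq p.+1 | p <- iota 0 (size word)
                   & nth 0%N [seq track l | l <- word] p == t].

(* The minor of the chamber of track t with left boundary p. *)
Definition chamber_minor (n : nat) (word : seq letter) (t p : nat) :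
    minor_index n :=
  (labels_upto n t (wires_at n word p).1,
   labels_upto n t (wires_at n word p).2).

(* Minors of the chambers lying in tracks 1, ..., k. *)
Definition chamber_minors (n k : nat) (word : seq letter) :
    {set minor_index n} :=
  [set:: [seq chamber_minor n word t p | t <- iota 1 k, p <- chambers word t]].

(* A Young diagram in the (n-1) x (n-1) square (English notation) is its set of
   boxes (row, column), rows being numbered from top to bottom. *)
Notation boxes n := {set 'I_n.-1 * 'I_n.-1}.

Definition is_young (n : nat) (Y : boxes n) : Prop :=
  forall i j i' j' : 'I_n.-1,
    (i, j) \in Y -> (i' <= i)%N -> (j' <= j)%N -> (i', j') \in Y.

Definition adds_one_box (n : nat) (Y Y' : boxes n) : Prop :=
  exists2 b, b \notin Y & Y' = b |: Y.

Definition row_length (n : nat) (Y : boxes n) (i : nat) : nat :=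
  #|[set b in Y | b.1.+1 == i]|.

(* r_i = e_{n-i} ... e_1 and b_i = f_1 ... f_{n-i}. *)
Definition red_block (n i : nat) : seq letter :=
  [seq red_cross s | s <- rev (iota 1 (n - i))].

Definition blue_block (n i : nat) : seq letter :=
  [seq blue_cross s | s <- iota 1 (n - i)].

(* The r_i inserted between b_j and b_{j+1}, by decreasing i. *)
Definition gap (n : nat) (Y : boxes n) (j : nat) : seq letter :=
  flatten [seq red_block n i | i <- rev (iota 1 n.-1) & row_length Y i == j].

Definition diagram (n : nat) (Y : boxes n) : seq letter :=
  gap Y 0 ++ flatten [seq blue_block n j ++ gap Y j | j <- iota 1 n.-1].

Definition test_minors (n k : nat) (Y : boxes n) : {set minor_index n} :=
  chamber_minors n k (diagram Y) :|: solid_minors n k.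

(* Main.v *)
Require Import Defs.
From mathcomp Require Import all_boot all_order all_algebra.
From mathcomp Require Import reals.
From mathcomp Require Import perm zify ring.

Set Implicit Arguments.
Unset Strict Implicit.
Unset Printing Implicit Defensive.

Import Order.TTheory GRing.Theory Num.Theory.

Local Open Scope ring_scope.

(* In track t the wires below a chamber always form intervals, so every chamber
   minor is a solid minor; recording its top left corner, the chambers of track
   t trace the boundary of Y cut off by the square of side n - t.  This path
   meets every diagonal exactly once, which gives the cardinality.

   The Desnanot-Jacobi identity
     D_(t+1)(a,b) D_(t-1)(a+1,b+1) =
       D_t(a,b) D_t(a+1,b+1) - D_t(a,b+1) D_t(a+1,b)
   for solid minors propagates positivity from these paths (and from all solid
   k-minors) to every solid minor of order at most k.  By Fekete's argument,
   positivity of the solid minors of order at most k survives the deletion of a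
   row or a column, thanks to a three-term Pluecker relation, itself a case of
   Desnanot-Jacobi; deleting all unused rows and columns turns any minor into a
   solid one. *)

(** * Determinantal identities *)

(** Entries are indexed by all of [nat], so that submatrices arise by composing with [succn], [bump]
    or a shift, without casts between ordinals. *)
Definition ndet (R : comNzRingType) (p : nat) (F : nat -> nat -> R) : R :=
  \det (\matrix_(i < p, j < p) F i j).

Lemma eq_ndet (R : comNzRingType) p (F G : nat -> nat -> R) :
  (forall i j, (i < p)%N -> (j < p)%N -> F i j = G i j) -> ndet p F = ndet p G.
Proof. by move=> eqFG; congr (\det _); apply/matrixP=> i j; rewrite !mxE eqFG. Qed.

Lemma ndet_tr (R : comNzRingType) p (F : nat -> nat -> R) :
  ndet p (fun i j => F j i) = ndet p F.
Proof. by rewrite /ndet -det_tr; congr (\det _); apply/matrixP=> i j; rewrite !mxE. Qed.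

Lemma ndet0 (R : comNzRingType) (F : nat -> nat -> R) : ndet 0 F = 1.
Proof. exact: det_mx00. Qed.

Lemma det_mx22 (R : comNzRingType) (A : 'M[R]_2) :
  \det A = A 0 0 * A 1 1 - A 0 1 * A 1 0.
Proof.
rewrite (expand_det_row _ 0) big_ord_recl big_ord1 /cofactor !det_mx11 !mxE /=.
rewrite expr0 expr1 mul1r mulN1r mulrN.
by congr (A 0 _ * A _ _ - A 0 _ * A _ _); apply: val_inj.
Qed.

(** Block elimination: an upper unitriangular factor clears the block above [S]. *)
Lemma det_schur (R : fieldType) (q m : nat) (P : 'M[R]_q) (Q : 'M_(q, m))
    (U : 'M_(m, q)) (S : 'M_m) :
  S \in unitmx -> \det (block_mx P Q U S) = \det S * \det (P - Q *m invmx S *m U).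
Proof.
move=> uS.
have -> : block_mx P Q U S = block_mx 1%:M (Q *m invmx S) 0 1%:M *m
                             block_mx (P - Q *m invmx S *m U) 0 U S.
  by rewrite mulmx_block !mul1mx !mul0mx ?mulmx0 !add0r mulmxKV // subrK.
by rewrite det_mulmx det_ublock det_lblock !det1 !mul1r mulrC.
Qed.

(** The Schur complement [K] of the common block [S] turns each bordered minor into [\det S] times
    an entry of [K], and the full determinant into [\det S] times a 2 x 2 determinant of [K]. *)
Lemma sylvester2 (R : fieldType) m (F : nat -> nat -> R) :
  ndet m (fun i j => F i.+2 j.+2) != 0 ->
  ndet m.+2 F * ndet m (fun i j => F i.+2 j.+2) =
    ndet m.+1 (fun i j => F (bump 1 i) (bump 1 j)) *
      ndet m.+1 (fun i j => F i.+1 j.+1)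
  - ndet m.+1 (fun i j => F (bump 1 i) j.+1) *
      ndet m.+1 (fun i j => F i.+1 (bump 1 j)).
Proof.
set S := \matrix_(i < m, j < m) F i.+2 j.+2 => nzS.
have uS : S \in unitmx by rewrite unitmxE unitfE.
pose q r := \row_(j < m) F r j.+2; pose u c := \col_(i < m) F i.+2 c.
pose K r c := F r c - (q r *m invmx S *m u c) 0 0.
have bordered (f g : nat -> nat) : (forall i, f i.+1 = i.+2) ->
    (forall j, g j.+1 = j.+2) ->
    ndet m.+1 (fun i j => F (f i) (g j)) = \det S * K (f 0%N) (g 0%N).
  move=> fS gS; rewrite /ndet.
  have E : \matrix_(i < 1 + m, j < 1 + m) F (f i) (g j) =
      block_mx (\matrix_(i < 1, j < 1) F (f 0%N) (g 0%N)) (q (f 0%N)) (u (g 0%N)) S.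
    apply/matrixP=> i j; rewrite !mxE.
    by case: splitP => i' ei; rewrite !mxE; case: splitP => j' ej;
      rewrite !mxE ei ej ?ord1 ?add1n ?fS ?gS.
  rewrite -[m.+1]/(1 + m)%N E.
  by rewrite (det_schur _ _ _ uS) det_mx11 !mxE /K mxE.
have -> : ndet m.+2 F = \det S * (K 0%N 0%N * K 1%N 1%N - K 0%N 1%N * K 1%N 0%N).
  rewrite /ndet.
  have E : \matrix_(i < 2 + m, j < 2 + m) F i j =
      block_mx (\matrix_(i < 2, j < 2) F i j) (\matrix_(i < 2, j < m) F i j.+2)
               (\matrix_(i < m, j < 2) F i.+2 j) S.
    apply/matrixP=> i j; rewrite !mxE.
    by case: splitP => i' ei; rewrite !mxE; case: splitP => j' ej;
      rewrite !mxE ei ej.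
  rewrite -[m.+2]/(2 + m)%N E (det_schur _ _ _ uS) det_mx22; congr (_ * _).
  have KE (r c : 'I_2) : (\matrix_(i < 2, j < 2) F i j -
      \matrix_(i < 2, j < m) F i j.+2 *m invmx S *m \matrix_(i < m, j < 2) F i.+2 j)
      r c = K r c.
    rewrite !mxE /K !mxE; congr (_ - _); apply: eq_bigr => j _; rewrite !mxE.
    by congr (_ * _); apply: eq_bigr => i _; rewrite !mxE.
  by rewrite !KE.
rewrite -/(ndet m _) (bordered (bump 1) (bump 1)) // (bordered succn succn) //.
rewrite (bordered (bump 1) succn) // (bordered succn (bump 1)) //=.
rewrite -/S /ndet -/S /bump /=; ring.
Qed.

(** The sign depends on [g] alone, so it cancels when [g] acts on both rows and columns. *)
Lemma ndet_perm_rows (R : comNzRingType) p (g : nat -> nat) :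
  (forall i, (i < p)%N -> (g i < p)%N) ->
  (forall i j, (i < p)%N -> (j < p)%N -> g i = g j -> i = j) ->
  exists e : bool, forall F : nat -> nat -> R,
    ndet p (fun i j => F (g i) j) = (-1) ^+ e * ndet p F.
Proof.
move=> gp gI; pose s0 (i : 'I_p) := Ordinal (gp i (ltn_ord i)).
have s0I : injective s0.
  by move=> i j [] /gI eij; apply/val_inj/eij.
exists (perm s0I : bool) => F; rewrite -det_perm -det_mulmx -row_permE.
by congr (\det _); apply/matrixP=> i j; rewrite !mxE permE.
Qed.

Definition rotn (m i : nat) : nat := if i is i'.+1 then i' else m.

Lemma desnanot_jacobi (R : fieldType) m (F : nat -> nat -> R) :
  ndet m (fun i j => F i.+1 j.+1) != 0 ->
  ndet m.+2 F * ndet m (fun i j => F i.+1 j.+1) =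
    ndet m.+1 F * ndet m.+1 (fun i j => F i.+1 j.+1)
  - ndet m.+1 (fun i j => F i j.+1) * ndet m.+1 (fun i j => F i.+1 j).
Proof.
move=> nz.
have [e rotE] : exists e : bool, forall F : nat -> nat -> R,
    ndet m.+1 (fun i j => F (rotn m i) j) = (-1) ^+ e * ndet m.+1 F.
  by apply: ndet_perm_rows => [[|i]|[|i] [|j]] //=; lia.
(* [rot1] fixes 0, sends 1 to [m.+1] and shifts the others down by one: the central block becomes
   the lower right block of [sylvester2]. *)
pose rot1 i := if i is i'.+1 then (rotn m i').+1 else 0%N.
have [e1 rot1E] : exists e : bool, forall F : nat -> nat -> R,
    ndet m.+2 (fun i j => F (rot1 i) j) = (-1) ^+ e * ndet m.+2 F.
  by apply: ndet_perm_rows => [[|[|i]]|[|[|i]] [|[|j]]] //=; lia.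
have rot1B i : rot1 (bump 1 i) = i by case: i.
have ee (b : bool) (x : R) : (-1) ^+ b * ((-1) ^+ b * x) = x.
  by rewrite mulrA -signr_addb addbb mul1r.
have tr2 p (G H : nat -> nat -> R) : (forall i j, G i j = H j i) -> ndet p G = ndet p H.
  by move=> GH; rewrite -(ndet_tr p H); apply: eq_ndet.
pose G i j := F (rot1 i) (rot1 j).
have -> : ndet m.+2 F = ndet m.+2 G.
  rewrite (rot1E (fun i j => F i (rot1 j))).
  by rewrite -[ndet _ (fun i j => F i (rot1 j))]ndet_tr (rot1E (fun i j => F j i)) ndet_tr ee.
rewrite (@sylvester2 _ m G) //.
congr (_ * _ - _).
- by apply: eq_ndet => i j _ _; rewrite /G !rot1B.
- rewrite (rotE (fun i j => F i.+1 (rotn m j).+1)).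
  rewrite -[ndet _ (fun i j => F i.+1 (rotn m j).+1)]ndet_tr.
  by rewrite (rotE (fun i j => F j.+1 i.+1)) (ndet_tr _ (fun i j => F i.+1 j.+1)) ee.
have -> : ndet m.+1 (fun i j => G (bump 1 i) j.+1) =
    (-1) ^+ e * ndet m.+1 (fun i j => F i j.+1).
  rewrite -(ndet_tr _ (fun i j => F i j.+1)) -(rotE (fun i j => F j i.+1)).
  by apply: tr2 => i j; rewrite /G rot1B.
have -> : ndet m.+1 (fun i j => G i.+1 (bump 1 j)) =
    (-1) ^+ e * ndet m.+1 (fun i j => F i.+1 j).
  by rewrite -(rotE (fun i j => F i.+1 j)); apply: eq_ndet => i j _ _; rewrite /G rot1B.
by rewrite mulrACA -signr_addb addbb mul1r.
Qed.

Lemma ndet_last_row_delta (R : comNzRingType) p q (F : nat -> nat -> R) :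
  (q <= p)%N -> (forall j, F p j = (j == q)%:R) ->
  ndet p.+1 F = (-1) ^+ (p + q) * ndet p (fun i j => F i (bump q j)).
Proof.
move=> qp Fp; rewrite /ndet (expand_det_row _ ord_max).
have lt_q : (q < p.+1)%N by [].
rewrite (bigD1 (Ordinal lt_q)) //= big1 ?addr0 => [|j nj].
  rewrite mxE /= Fp eqxx mul1r /cofactor /=; congr (_ * \det _).
  by apply/matrixP=> i j; rewrite !mxE /= /bump leqNgt ltn_ord.
rewrite mxE /= Fp -[val j == q]/(j == Ordinal lt_q) (negPf nj) mul0r //.
Qed.

(* Desnanot-Jacobi for the matrix with the unit vector at q appended to F as
   last row. *)
Lemma ndet_plucker (R : fieldType) p q (F : nat -> nat -> R) :
  (0 < q <= p)%N -> ndet p (fun i j => F i.+1 j.+1) != 0 ->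
  ndet p.+1 (fun i j => F i (bump q j)) * ndet p (fun i j => F i.+1 j.+1) =
    ndet p.+1 F * ndet p (fun i j => F i.+1 (bump q j.+1))
  + ndet p.+1 (fun i j => F i j.+1) * ndet p (fun i j => F i.+1 (bump q j)).
Proof.
case/andP=> q0 qp nz.
pose B i j := if i == p.+1 then (j == q)%:R else F i j.
have BF (f g : nat -> nat) r : (forall i, (i < r)%N -> (f i < p.+1)%N) ->
    ndet r (fun i j => B (f i) (g j)) = ndet r (fun i j => F (f i) (g j)).
  by move=> fp; apply: eq_ndet => i j /fp lt_f _; rewrite /B ltn_eqF.
have inner : ndet p (fun i j => B i.+1 j.+1) = ndet p (fun i j => F i.+1 j.+1).
  by rewrite (BF succn succn).
have := @desnanot_jacobi _ p B; rewrite inner => /(_ nz).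
rewrite (@ndet_last_row_delta _ p.+1 q) ?leqW //; last by move=> j; rewrite /B eqxx.
(* Without column 0 the unit vector sits at [q.-1], hence the condition [0 < q]. *)
rewrite (@ndet_last_row_delta _ p q.-1 (fun i j => B i.+1 j.+1)); last 2 first.
- lia.
- by move=> j; rewrite /B eqxx; have -> : (j.+1 == q) = (j == q.-1) by lia.
rewrite (@ndet_last_row_delta _ p q (fun i j => B i.+1 j)) //; last first.
  by move=> j; rewrite /B eqxx.
rewrite (BF id (bump q)) // (BF id id) // (BF id succn) // (BF succn (bump q)) //.
rewrite (BF succn (fun j => (bump q.-1 j).+1)) //.
have -> : ndet p (fun i j => F i.+1 (bump q.-1 j).+1) =
          ndet p (fun i j => F i.+1 (bump q j.+1)).
  by apply: eq_ndet => i j _ _; congr (F _ _); rewrite /bump; lia.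
have -> : ((-1) ^+ (p + q.-1) : R) = (-1) ^+ (p.+1 + q).
  by rewrite -signr_odd -[RHS]signr_odd; congr (_ ^+ _); lia.
(* Only this factor has the opposite sign, which turns the minus of Desnanot-Jacobi into a plus. *)
have -> : ((-1) ^+ (p + q) : R) = - (-1) ^+ (p.+1 + q) by rewrite addSn exprS mulN1r opprK.
set e := (-1) ^+ (p.+1 + q) => eq_e.
have nze : e != 0 by rewrite signr_eq0.
apply: (mulfI nze); rewrite mulrA eq_e; ring.
Qed.

(** * Positivity of minors from solid minors *)

Definition solid_pos (R : realFieldType) (k m n : nat) (F : nat -> nat -> R) :=
  forall p i j, (p <= k)%N -> (i + p <= m)%N -> (j + p <= n)%N ->
    0 < ndet p (fun a b => F (i + a)%N (j + b)%N).

Lemma solid_pos_tr (R : realFieldType) k m n (F : nat -> nat -> R) :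
  solid_pos k m n F -> solid_pos k n m (fun a b => F b a).
Proof. by move=> sF p i j pk ip jp; rewrite -ndet_tr; apply: sF. Qed.

Lemma eq_solid_pos (R : realFieldType) k m n (F G : nat -> nat -> R) :
  (forall i j, (j < n)%N -> F i j = G i j) -> solid_pos k m n F -> solid_pos k m n G.
Proof.
move=> FG sF p i j pk ip jp.
rewrite -(eq_ndet (F := fun a b => F (i + a)%N (j + b)%N)); first exact: sF.
by move=> a b _ bp; apply: FG; lia.
Qed.

(** Induction on the order. A window straddling column [c] is handled by [ndet_plucker]: up to the
    positive factor [inner], its minor is a sum of two products of a solid minor of [F] and a
    smaller minor of the same deleted array. *)
Lemma solid_pos_del_col (R : realFieldType) k m n c (F : nat -> nat -> R) :
  solid_pos k m n.+1 F -> solid_pos k m n (fun a b => F a (bump c b)).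
Proof.
move=> sF; elim=> [|p IHp] i j pk ip jp; first by rewrite ndet0.
have [cj | jc] := leqP c j.
  rewrite (eq_ndet (G := fun a b => F (i + a)%N (j.+1 + b)%N)); last first.
    by move=> a b _ _; congr (F _ _); rewrite /bump; lia.
  by apply: sF; lia.
have [jpc | cjp] := leqP (j + p.+1) c.
  rewrite (eq_ndet (G := fun a b => F (i + a)%N (j + b)%N)); last first.
    by move=> a b _ bp; congr (F _ _); rewrite /bump; lia.
  by apply: sF; lia.
pose G a b := F (i + a)%N (j + b)%N.
have inner : 0 < ndet p (fun a b => G a.+1 b.+1).
  rewrite (eq_ndet (G := fun a b => F (i.+1 + a)%N (j.+1 + b)%N)).
    by apply: sF; lia.
  by move=> a b _ _; rewrite /G !addnS.
have := @ndet_plucker _ p (c - j) G; rewrite gt_eqF // => /(_ _ isT) pl.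
have -> : ndet p.+1 (fun a b => F (i + a)%N (bump c (j + b))) =
          ndet p.+1 (fun a b => G a (bump (c - j) b)).
  by apply: eq_ndet => a b _ _; congr (F _ _); rewrite /bump; lia.
rewrite -(pmulr_lgt0 _ inner) pl; last lia.
have {}IHp i' j' : (i' + p <= m)%N -> (j' + p <= n)%N ->
    0 < ndet p (fun a b => F (i' + a)%N (bump c (j' + b))) by apply: IHp; lia.
apply: addr_gt0; apply: mulr_gt0.
- by apply: sF; lia.
- rewrite (eq_ndet (G := fun a b => F (i.+1 + a)%N (bump c (j.+1 + b)))).
    by apply: IHp; lia.
  by move=> a b _ _; congr (F _ _); rewrite /bump; lia.
- rewrite (eq_ndet (G := fun a b => F (i + a)%N (j.+1 + b)%N)); first by apply: sF; lia.
  by move=> a b _ _; congr (F _ _); lia.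
- rewrite (eq_ndet (G := fun a b => F (i.+1 + a)%N (bump c (j + b)))).
    by apply: IHp; lia.
  by move=> a b _ _; congr (F _ _); rewrite /bump; lia.
Qed.

(** Induction on the number of columns: the first index that [g] moves is a column outside its
    image; it is deleted and [g] is renumbered by [unbump]. *)
Lemma solid_pos_sub_cols (R : realFieldType) k m n p (g : nat -> nat) (F : nat -> nat -> R) :
  (forall a b, (a < b < p)%N -> (g a < g b)%N) ->
  (forall a, (a < p)%N -> (g a < n)%N) ->
  solid_pos k m n F -> solid_pos k m p (fun a b => F a (g b)).
Proof.
elim: n g F => [|n IHn] g F gI gn sF.
  case: p gI gn => [|p] gI gn; last by have := gn 0%N isT.
  exact: eq_solid_pos sF.
have [c cg] : exists c, ((c < p)%N || (c == p)) && ((c == p) || (g c != c)).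
  by exists p; rewrite eqxx orbT.
have [c' c'P c'min] := ex_minnP (ex_intro (fun c => is_true _) c cg).
have gc' : (c' < p)%N -> g c' != c'.
  by case/andP: c'P => _ /orP[/eqP -> | //]; rewrite ltnn.
have gid a : (a < c')%N -> (a < p)%N -> g a = a.
  move=> ac ap; apply/eqP; apply: contraLR ac => nga; rewrite -leqNgt.
  by apply: c'min; rewrite ap nga orbT.
have ge a : (a < p)%N -> (a <= g a)%N.
  elim: a => // a IHa ap; apply: leq_ltn_trans (gI a a.+1 _); [apply: IHa; lia | lia].
have gc a : (a < p)%N -> (c' <= a)%N -> (c' < g a)%N.
  move=> ap; rewrite leq_eqVlt => /orP[/eqP eca|lt_ca].
    subst a; rewrite ltn_neqAle eq_sym gc' //; exact: ge.
  by have := gI c' a; rewrite lt_ca ap => /(_ isT); have := ge c'; lia.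
have pn : (p <= n.+1)%N.
  case: p gn ge {IHn gI c cg c' c'P c'min gc' gid gc} => // p gn ge.
  by have := gn p; have := ge p; lia.
have [cp | np] := leqP c' n; last first.
  apply: (@eq_solid_pos _ _ _ _ F) => [a b bp|q i j qk iq jq]; last first.
    apply: sF => //; lia.
  by rewrite gid //; have := gn b bp; have := ge b bp; lia.
pose g' := unbump c' \o g.
have gE a : (a < p)%N -> bump c' (g' a) = g a.
  move=> ap; rewrite /g' /= unbumpK //= inE.
  by have := gc a ap; have := gid a; lia.
apply: (@eq_solid_pos _ _ _ _ (fun a b => F a (bump c' (g' b)))).
  by move=> a b bp; rewrite gE.
apply: (IHn g' (fun a b => F a (bump c' b))) => [a b ab|a ap|].
- have := gI a b ab; rewrite -!gE; try lia.
  rewrite /bump; lia.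
- have := gn a ap; rewrite -gE // /bump; lia.
- exact: solid_pos_del_col.
Qed.

(** Columns first, then rows through the transpose; the minor is then the solid one at the
    origin. *)
Lemma solid_pos_minor (R : realFieldType) k m n p (f g : nat -> nat) (F : nat -> nat -> R) :
  (p <= k)%N ->
  (forall a b, (a < b < p)%N -> (f a < f b)%N) ->
  (forall a, (a < p)%N -> (f a < m)%N) ->
  (forall a b, (a < b < p)%N -> (g a < g b)%N) ->
  (forall a, (a < p)%N -> (g a < n)%N) ->
  solid_pos k m n F -> 0 < ndet p (fun a b => F (f a) (g b)).
Proof.
move=> pk fI fm gI gn sF.
have sFg := solid_pos_sub_cols gI gn sF.
have := solid_pos_sub_cols fI fm (solid_pos_tr sFg).
by move=> /solid_pos_tr /(_ p 0%N 0%N pk (leqnn _) (leqnn _)).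
Qed.

(** * From matrices indexed by ordinals to arrays indexed by natural numbers *)

Definition entry (R : comNzRingType) n (M : 'M[R]_n.+1) (x y : nat) : R :=
  M (inord x) (inord y).

Definition enum_nat n (I : {set 'I_n}) : seq nat := [seq val x | x <- enum I].

Lemma size_enum_nat n (I : {set 'I_n}) : size (enum_nat I) = #|I|.
Proof. by rewrite size_map -cardE. Qed.

Lemma enum_nat_sorted n (I : {set 'I_n}) : sorted ltn (enum_nat I).
Proof.
apply: (subseq_sorted ltn_trans _ (iota_ltn_sorted 0 n)).
rewrite -val_enum_ord; apply: map_subseq.
by rewrite [X in subseq _ X]enumT; apply: filter_subseq.
Qed.

Lemma mem_enum_nat n (I : {set 'I_n}) (x : 'I_n) : (val x \in enum_nat I) = (x \in I).
Proof. by rewrite mem_map ?mem_enum //; apply: val_inj. Qed.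

Lemma enum_nat_lt n (I : {set 'I_n}) x : x \in enum_nat I -> (x < n)%N.
Proof. by case/mapP=> y _ ->; apply: ltn_ord. Qed.

Lemma enum_nat_interval n t a : (a + t <= n)%N -> enum_nat (Defs.interval n t a) = iota a t.
Proof.
move=> atn; apply: (irr_sorted_eq ltn_trans ltnn); first exact: enum_nat_sorted.
  exact: iota_ltn_sorted.
move=> x; rewrite mem_iota; apply/idP/idP => [xI | xI].
  by have xn := enum_nat_lt xI; move: xI; rewrite (mem_enum_nat _ (Ordinal xn)) inE.
have xn : (x < n)%N by lia.
by rewrite (mem_enum_nat _ (Ordinal xn)) inE.
Qed.

Lemma card_interval n t a : (a + t <= n)%N -> #|Defs.interval n t a| = t.
Proof. by move=> atn; rewrite -size_enum_nat enum_nat_interval // size_iota. Qed.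

Lemma interval_inj n t a t' a' : (0 < t)%N -> (a + t <= n)%N -> (a' + t' <= n)%N ->
  Defs.interval n t a = Defs.interval n t' a' -> t = t' /\ a = a'.
Proof.
move=> t0 atn atn' eqI; have := enum_nat_interval atn.
rewrite eqI enum_nat_interval // => eqi.
have ett' : t = t' by have := congr1 size eqi; rewrite !size_iota.
by subst t'; move: eqi; case: (t) t0 => // t1 _ [].
Qed.

Lemma minor_ndet (R : comNzRingType) n (M : 'M[R]_n.+1) (I J : {set 'I_n.+1}) :
  #|I| = #|J| ->
  minor M (I, J) = ndet #|I| (fun a b =>
    entry M (nth 0%N (enum_nat I) a) (nth 0%N (enum_nat J) b)).
Proof.
move=> cIJ; congr (\det _); apply/matrixP=> a b; rewrite !mxE /=.
rewrite /entry; congr (M _ _); apply: val_inj => /=; rewrite inordK.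
- by rewrite (nth_map (enum_val a)) -?cardE // -enum_val_nth. 
- by apply/(@enum_nat_lt _ I)/mem_nth; rewrite size_enum_nat.
- by rewrite (nth_map (enum_val a)) -?cardE -?cIJ.
- by apply/(@enum_nat_lt _ J)/mem_nth; rewrite size_enum_nat -cIJ.
Qed.

Lemma minor_solid (R : comNzRingType) n (M : 'M[R]_n.+1) t a b :
  (a + t <= n.+1)%N -> (b + t <= n.+1)%N ->
  minor M (Defs.interval n.+1 t a, Defs.interval n.+1 t b) =
    ndet t (fun i j => entry M (a + i) (b + j)).
Proof.
move=> atn btn; rewrite minor_ndet !card_interval // !enum_nat_interval //.
by apply: eq_ndet => i j it jt; rewrite !nth_iota.
Qed.

Lemma solid_pos_k_positive (R : realType) n k (M : 'M[R]_n.+1) :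
  solid_pos k n.+1 n.+1 (entry M) -> k_positive k M.
Proof.
move=> sM I J cIJ /andP[_ Ik]; rewrite minor_ndet //.
have incr (K : {set 'I_n.+1}) : #|K| = #|I| -> forall a b, (a < b < #|I|)%N ->
    (nth 0%N (enum_nat K) a < nth 0%N (enum_nat K) b)%N.
  move=> cK a b /andP[ab bI].
  by apply: (sorted_ltn_nth ltn_trans 0%N (enum_nat_sorted K)) => //;
    rewrite inE size_enum_nat cK //; apply: ltn_trans bI.
have bnd (K : {set 'I_n.+1}) : #|K| = #|I| -> forall a, (a < #|I|)%N ->
    (nth 0%N (enum_nat K) a < n.+1)%N.
  by move=> cK a aI; apply/(@enum_nat_lt _ K)/mem_nth; rewrite size_enum_nat cK.
by apply: (solid_pos_minor Ik _ _ _ _ sM); auto.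
Qed.

(* The solid t-minor with top left corner (a, b), both 0-based, is a chamber
   minor iff (a, b) lies on the boundary path of the diagram with row lengths
   [ell] (rows numbered from 1) inside the square of side n - t. *)
Definition on_path (n : nat) (ell : nat -> nat) (t a b : nat) : bool :=
  [&& a + t <= n, b + t <= n,
      [|| a == 0, b == 0 | b <= ell a]
    & [|| a + t == n, b + t == n | ell a.+1 <= b]]%N.

(* Induction on a + b, then on t, below the path, and the mirrored induction
   above it: Desnanot-Jacobi expresses the minor at one end of a diagonal step
   through minors met earlier. *)
Lemma solid_pos_of_path (R : realFieldType) n k (ell : nat -> nat)
    (F : nat -> nat -> R) :
  (forall i, (0 < i)%N -> (ell i.+1 <= ell i)%N) ->
  (forall a b, (a + k <= n)%N -> (b + k <= n)%N ->
     0 < ndet k (fun i j => F (a + i)%N (b + j)%N)) ->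
  (forall t a b, (0 < t <= k)%N -> on_path n ell t a b ->
     0 < ndet t (fun i j => F (a + i)%N (b + j)%N)) ->
  solid_pos k n n F.
Proof.
move=> ell_anti pos_k pos_path.
pose S t a b := ndet t (fun i j => F (a + i)%N (b + j)%N).
have S0 a b : 0 < S 0 a b by rewrite /S ndet0.
have DJ t a b : 0 < S t a.+1 b.+1 -> S t.+2 a b * S t a.+1 b.+1 =
    S t.+1 a b * S t.+1 a.+1 b.+1 - S t.+1 a b.+1 * S t.+1 a.+1 b.
  have shift1 t' : S t' a.+1 b.+1 =
      ndet t' (fun i j => F (a + i.+1)%N (b + j.+1)%N).
    by apply: eq_ndet => i j _ _; rewrite !addnS.
  have shift2 t' : S t' a b.+1 = ndet t' (fun i j => F (a + i)%N (b + j.+1)%N).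
    by apply: eq_ndet => i j _ _; rewrite !addnS.
  have shift3 t' : S t' a.+1 b = ndet t' (fun i j => F (a + i.+1)%N (b + j)%N).
    by apply: eq_ndet => i j _ _; rewrite !addnS.
  rewrite !shift1 shift2 shift3 => nz.
  by rewrite (@desnanot_jacobi _ _ (fun i j => F (a + i)%N (b + j)%N)) // gt_eqF.
(* Within the bounds, [on_path] is the conjunction of [inner] and [outer]. *)
pose inner (a b : nat) := [|| a == 0, b == 0 | b <= ell a]%N.
pose outer (t a b : nat) := [|| a + t == n, b + t == n | ell a.+1 <= b]%N.
have pos_outer s t a b : (a + b < s)%N -> (t <= k)%N -> (a + t <= n)%N ->
    (b + t <= n)%N -> outer t a b -> 0 < S t a b.
  elim: s t a b => // s IHs; elim=> // t IHt a b abs tk atn btn out.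
  have [tk' | ntk] := eqVneq t.+1 k.
    by rewrite /S tk'; apply: pos_k; rewrite -tk'.
  have [inn | ninn] := boolP (inner a b).
    by apply: pos_path => //; apply/and4P; split.
  (* With both coordinates decremented, the wanted minor is the lower right factor of the relation
     at [(a, b)]; [S t a.+1 b.+1] has smaller order, the others a smaller corner sum. *)
  case: a b ninn abs atn btn out => [|a] [|b] // ninn abs atn btn out.
  move: ninn; rewrite /inner /= -ltnNge => ninn.
  have pt : 0 < S t a.+1 b.+1.
    by apply: IHt => //; try lia; rewrite /outer; have := ell_anti a.+1 isT; lia.
  have pab : 0 < S t.+1 a b by apply: IHs; rewrite /outer; lia.
  have pab1 : 0 < S t.+1 a b.+1 by apply: IHs; rewrite /outer; lia.
  have pa1b : 0 < S t.+1 a.+1 b.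
    by apply: IHs; rewrite /outer; have := ell_anti a.+1 isT; lia.
  have pt2 : 0 < S t.+2 a b by apply: IHs; rewrite /outer; lia.
  rewrite -(pmulr_rgt0 _ pab).
  have -> : S t.+1 a b * S t.+1 a.+1 b.+1 =
      S t.+2 a b * S t a.+1 b.+1 + S t.+1 a b.+1 * S t.+1 a.+1 b.
    by rewrite DJ // subrK.
  by apply: addr_gt0; apply: mulr_gt0.
have pos_inner s d t a b : ((n - a) + (n - b) < s)%N -> (k - t < d)%N -> (t <= k)%N ->
    (a + t <= n)%N -> (b + t <= n)%N -> inner a b -> 0 < S t a b.
  elim: s d t a b => // s IHs; elim=> // d IHd [|t] a b // abs td tk atn btn inn.
  have [tk' | ntk] := eqVneq t.+1 k.
    by rewrite /S tk'; apply: pos_k; rewrite -tk'.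
  have [out | nout] := boolP (outer t.+1 a b).
    by apply: pos_path => //; apply/and4P; split.
  (* Now the wanted minor is the upper left factor: [S t.+2 a b] has order nearer to [k], the others
     a corner nearer to [n]. *)
  move: nout; rewrite /outer !negb_or -ltnNge => /and3P[na nb nout].
  have pt2 : 0 < S t.+2 a b by apply: IHd => //; lia.
  have pa1b1 : 0 < S t.+1 a.+1 b.+1 by apply: (IHs k.+1); rewrite /inner; lia.
  have pt : 0 < S t a.+1 b.+1 by apply: (IHs k.+1); rewrite /inner; lia.
  have pab1 : 0 < S t.+1 a b.+1.
    apply: (IHs k.+1); rewrite /inner; try lia.
    by case: a {IHd pt2 abs pa1b1 pt} nout na atn inn => // a; have := ell_anti a.+1 isT; lia.
  have pa1b : 0 < S t.+1 a.+1 b by apply: (IHs k.+1); rewrite /inner; lia.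
  rewrite -(pmulr_lgt0 _ pa1b1).
  have -> : S t.+1 a b * S t.+1 a.+1 b.+1 =
      S t.+2 a b * S t a.+1 b.+1 + S t.+1 a b.+1 * S t.+1 a.+1 b.
    by rewrite DJ // subrK.
  by apply: addr_gt0; apply: mulr_gt0.
move=> t a b tk atn btn; rewrite -/(S t a b).
have [out | nout] := boolP (outer t a b); first exact: (pos_outer (a + b).+1).
have [inn | ninn] := boolP (inner a b).
  exact: (pos_inner ((n - a) + (n - b)).+1 (k - t).+1).
exfalso; move: nout ninn; rewrite /outer /inner !negb_or -!ltnNge.
by case: a atn => // a atn /and3P[_ _ h1] /and3P[_ _ h2]; have := ell_anti a.+1 isT; lia.
Qed.

(** * Wires of a double wiring diagram *)

Local Open Scope nat_scope.

(* Conditions on the numbers of earlier crossings in the tracks s-1, s and s+1;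
   they hold at every letter of both the red and the blue word of D(Y), so the
   two colours can be treated by the same argument. *)
Definition admissible (u : seq nat) (s : nat) : bool :=
  [&& 0 < s, (s == 1) || (count_mem s.-1 u == (count_mem s u).+1)
    & count_mem s.+1 u == count_mem s u].

Fixpoint admissible_from (u w : seq nat) : bool :=
  if w is s :: w' then admissible u s && admissible_from (rcons u s) w' else true.

Lemma admissible_from_cat u v w :
  admissible_from u (v ++ w) = admissible_from u v && admissible_from (u ++ v) w.
Proof.
by elim: v u => [|s v IHv] u /=; rewrite ?cats0 // IHv cat_rcons andbA.
Qed.

Definition swaps (w : nat -> nat) (s : seq nat) : nat -> nat :=
  foldl (fun w s => swap s w) w s.

(* The wire at height h after admissible crossings, c h being the number of
   crossings in track h. *)
Definition wire_label (c : nat -> nat) (h : nat) : nat :=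
  if c h.-1 == c h then c h + h else (c h).+1.

(** Induction on the last letter [s]: its crossing alters [wire_label] only at heights [s] and
    [s.+1], and admissibility makes those two labels change places. *)
Lemma swaps_admissible (w : seq nat) (c := fun h => count_mem h w) :
  admissible_from [::] w ->
  [/\ c 0 = 0, forall h, 0 < h -> c h.+1 <= c h <= (c h.+1).+1
    & forall h, 0 < h -> swaps id w h = wire_label c h].
Proof.
rewrite {}/c; elim/last_ind: w => [|w s IHw] /=.
  by move=> _; split=> // h h0; rewrite /wire_label /=.
rewrite -cats1 admissible_from_cat /= andbT => /andP[/IHw[c0 cmon clab]].
have cE h : count_mem h (w ++ [:: s]) = count_mem h w + (s == h).
  by rewrite count_cat /= addn0.
rewrite /admissible => /and3P[s0 cs1 cs2].
split=> [|h h0|h h0].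
- by rewrite cE c0; case: (s) s0.
- rewrite !cE; have := cmon h h0.
  have [es|nes] := eqVneq s h; first by subst s; lia.
  have [es|nes'] := eqVneq s h.+1; last by lia.
  by subst s; move: cs1 => /=; lia.
- rewrite /swaps foldl_cat /= -/(swaps id w) /swap /wire_label !cE.
  have := cs1; have := cs2; have [->|nes] := eqVneq h s.
    rewrite clab // /wire_label /=; case: (eqVneq s 1) => [->|_] /=; rewrite ?c0.
      by do ?[case: ifP]; lia.
    by do ?[case: ifP]; lia.
  have [->|nes'] := eqVneq h s.+1.
    rewrite /= clab // /wire_label; case: (eqVneq s 1) => [->|_] /=; rewrite ?c0.
      by do ?[case: ifP]; lia.
    by do ?[case: ifP]; lia.
  rewrite clab // /wire_label => _ _.
  have -> : (s == h.-1) = false by lia.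
  by rewrite !addn0.
Qed.

Lemma iota1S m : iota 1 m.+1 = iota 1 m ++ [:: m.+1].
Proof. by rewrite -[LHS]/(iota 1 (1 + m)) addnC iotaD. Qed.

(** Passing from [t] to [t.+1] adds one label: on top of the interval if [c t.+1 = c t], just below
    it if [c t = (c t.+1).+1]. *)
Lemma wire_label_range (c : nat -> nat) t y :
  c 0 = 0 -> (forall h, 0 < h -> c h.+1 <= c h <= (c h.+1).+1) -> 0 < t ->
  (y \in [seq wire_label c h | h <- iota 1 t]) = (c t < y <= c t + t).
Proof.
move=> c0 cmon; elim: t => // -[_ _|t IHt _].
  rewrite /= inE /wire_label /=; case: ifP; lia.
rewrite iota1S map_cat mem_cat IHt //= inE /wire_label /=.
by have := cmon t.+1 isT; case: ifP; lia.
Qed.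

Definition reds (w : seq letter) : seq nat :=
  pmap (fun l => if l is red_cross s then Some s else None) w.

Definition blues (w : seq letter) : seq nat :=
  pmap (fun l => if l is blue_cross s then Some s else None) w.

Lemma foldl_cross (c : wires) (w : seq letter) :
  foldl cross c w = (swaps c.1 (reds w), swaps c.2 (blues w)).
Proof. by elim: w c => [|[s|s] w IHw] [r b] //=; rewrite IHw. Qed.

(** Crossings permute heights, so they commute with any relabelling [g] of the wires. *)
Lemma swaps_comp (g w0 w1 : nat -> nat) (u : seq nat) :
  (forall h, w0 h = g (w1 h)) -> forall h, swaps w0 u h = g (swaps w1 u h).
Proof.
elim: u w0 w1 => //= s u IHu w0 w1 w01; apply: IHu => h.
by rewrite /swap !w01; case: ifP => // _; case: ifP.
Qed.

Lemma labels_upto_blue n t (u : seq nat) : 0 < t -> admissible_from [::] u ->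
  labels_upto n t (swaps id u) = Defs.interval n t (count_mem t u).
Proof.
move=> t0 /swaps_admissible[c0 cmon lab]; apply/setP=> x; rewrite !inE.
rewrite (eq_in_map _ (wire_label (fun h => count_mem h u)) _).1.
  rewrite wire_label_range //; lia.
by move=> h; rewrite mem_iota => /andP[h0 _]; apply: lab.
Qed.

(* At the left end the red labels are the blue ones reflected by h |-> n+1-h. *)
Lemma labels_upto_red n t (u : seq nat) : 0 < t -> admissible_from [::] u ->
  count_mem t u + t <= n ->
  labels_upto n t (swaps (left_end n).1 u) =
    Defs.interval n t (n - t - count_mem t u).
Proof.
move=> t0 adm_u cn; apply/setP=> x; rewrite !inE.
have /setP/(_ (rev_ord x)) := labels_upto_blue n t0 adm_u; rewrite !inE /= => blue.
have -> : (x.+1 \in [seq swaps (left_end n).1 u h | h <- iota 1 t]) =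
    ((n - x.+1).+1 \in [seq swaps id u h | h <- iota 1 t]).
  have refl h : swaps (left_end n).1 u h = n.+1 - swaps id u h.
    exact: (swaps_comp (g := fun y => n.+1 - y)).
  have xn := ltn_ord x.
  by apply/mapP/mapP => -[h ht] eh; exists h => //; move: eh; rewrite refl; lia.
rewrite blue; move: cn (ltn_ord x); set c := count_mem t u; move: (nat_of_ord x) => x'. lia.
Qed.

Lemma count_mem_iota t a m : count_mem t (iota a m) = (a <= t < a + m) :> nat.
Proof. by rewrite count_uniq_mem ?iota_uniq // mem_iota. Qed.

(** Crossing [s] puts its count one above that of [s.+1], which is the condition for crossing [s.+1]
    next. *)
Lemma admissible_from_iota u s q :
  0 < s -> (s == 1) || (count_mem s.-1 u == (count_mem s u).+1) ->
  (forall h, s <= h <= s + q -> count_mem h u = count_mem s u) ->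
  admissible_from u (iota s q).
Proof.
elim: q s u => //= q IHq s u s0 cs cu; apply/andP; split.
  by apply/and3P; split=> //; apply/eqP/cu; lia.
have cE h : count_mem h (rcons u s) = count_mem h u + (s == h).
  by rewrite -cats1 count_cat /= addn0.
apply: IHq => // [|h hs]; rewrite !cE.
  by have := cu s.+1; rewrite /= eqxx; lia.
by rewrite (cu h) ?(cu s.+1); lia.
Qed.

(** Crossing the top track raises its count to that of the track beneath, which can then be crossed
    in turn. *)
Lemma admissible_from_rev_iota u m :
  (0 < m -> count_mem m.+1 u = count_mem m u) ->
  (forall h, 0 < h < m -> count_mem h u = (count_mem h.+1 u).+1) ->
  admissible_from u (rev (iota 1 m)).
Proof.
elim: m u => // m IHm u cm cu; rewrite iota1S rev_cat /=.
have cE h : count_mem h (rcons u m.+1) = count_mem h u + (m.+1 == h).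
  by rewrite -cats1 count_cat /= addn0.
apply/andP; split.
  apply/and3P; split=> //; last exact/eqP/cm.
  by case: m {IHm cE cm} cu => //= m cu; apply/eqP/cu; lia.
apply: IHm => [m0|h hm]; rewrite !cE; first by have := cu m; have := cm isT; lia.
by have := cu h; lia.
Qed.

(** * The words D(Y) and their chambers *)

Lemma row_length_lt n (Y : boxes n) i : 0 < n -> row_length Y i < n.
Proof.
move=> n0; rewrite /row_length.
have inj2 : {in [set b in Y | b.1.+1 == i] &, injective snd}.
  move=> [a b] [a' b']; rewrite !inE /= => /andP[_ /eqP ea] /andP[_ /eqP ea'] /= ->.
  by congr (_, _); apply: val_inj => /=; lia.
rewrite -(card_in_imset inj2); apply: leq_ltn_trans (max_card _) _.
by rewrite card_ord prednK.
Qed.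

Lemma row_length_anti n (Y : boxes n) i : is_young Y -> 0 < i ->
  row_length Y i.+1 <= row_length Y i.
Proof.
move=> yY i0; rewrite /row_length.
have inj2 : {in [set b in Y | b.1.+1 == i.+1] &, injective snd}.
  move=> [a b] [a' b']; rewrite !inE /= => /andP[_ /eqP ea] /andP[_ /eqP ea'] /= ->.
  by congr (_, _); apply: val_inj => /=; lia.
rewrite -(card_in_imset inj2).
apply: leq_trans (leq_imset_card snd _); apply: subset_leq_card.
apply/subsetP=> c /imsetP[[a b]]; rewrite inE /= => /andP[abY /eqP[ea] ->].
have lt_a : i.-1 < n.-1 by have := ltn_ord a; lia.
apply/imsetP; exists (Ordinal lt_a, b) => //; rewrite inE /= prednK // eqxx andbT.
by apply: yY abY _ _ => //=; lia.
Qed.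

Lemma antitone_pos (ell : nat -> nat) :
  (forall i, 0 < i -> ell i.+1 <= ell i) ->
  forall i j, 0 < i -> i <= j -> ell j <= ell i.
Proof.
move=> ell_anti i j i0; elim: j => [|j IHj]; first by lia.
rewrite leq_eqVlt => /orP[/eqP <- //|ij]; apply: leq_trans (IHj ij).
by apply: ell_anti => //; lia.
Qed.

(** * The red and blue subwords of D(Y) *)

Lemma reds_cat u v : reds (u ++ v) = reds u ++ reds v.
Proof. exact: pmap_cat. Qed.

Lemma blues_cat u v : blues (u ++ v) = blues u ++ blues v.
Proof. exact: pmap_cat. Qed.

Lemma reds_flatten ss : reds (flatten ss) = flatten (map reds ss).
Proof. by elim: ss => //= s ss IH; rewrite reds_cat IH. Qed.

Lemma blues_flatten ss : blues (flatten ss) = flatten (map blues ss).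
Proof. by elim: ss => //= s ss IH; rewrite blues_cat IH. Qed.

Lemma reds_red_block n i : reds (red_block n i) = rev (iota 1 (n - i)).
Proof. by rewrite /red_block; elim: (rev _) => //= s w ->. Qed.

Lemma blues_red_block n i : blues (red_block n i) = [::].
Proof. by rewrite /red_block; elim: (rev _). Qed.

Lemma reds_blue_block n i : reds (blue_block n i) = [::].
Proof. by rewrite /blue_block; elim: (iota _ _). Qed.

Lemma blues_blue_block n i : blues (blue_block n i) = iota 1 (n - i).
Proof. by rewrite /blue_block; elim: (iota _ _) => //= s w ->. Qed.

Definition red_word n (s : seq nat) : seq nat := flatten [seq rev (iota 1 (n - i)) | i <- s].

Lemma reds_gap n (Y : boxes n) j :
  reds (gap Y j) = red_word n [seq i <- rev (iota 1 n.-1) | row_length Y i == j].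
Proof.
rewrite /gap reds_flatten -map_comp; congr flatten.
by apply: eq_map => i /=; rewrite reds_red_block.
Qed.

Lemma blues_gap n (Y : boxes n) j : blues (gap Y j) = [::].
Proof.
rewrite /gap blues_flatten -map_comp; elim: [seq _ <- _ | _] => //= i s ->.
by rewrite blues_red_block.
Qed.

(** A list sorted by [ell] is the concatenation of its fibres. Applied to the rows in decreasing
    order, this shows that the gaps list the red blocks in an order independent of [Y]. *)
Lemma flatten_filter_fibres (ell : nat -> nat) (s : seq nat) J :
  sorted (fun x y => ell x <= ell y) s ->
  flatten [seq [seq i <- s | ell i == j] | j <- iota 0 J] = [seq i <- s | ell i < J].
Proof.
move=> s_sorted; elim: J => [|J IHJ].
  by rewrite /= (eq_filter (a2 := pred0)) ?filter_pred0.
rewrite -addn1 iotaD map_cat flatten_cat IHJ /= cats0 add0n addn1 {IHJ}.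
elim: s s_sorted => //= x s IHs pxs.
have sle : all (fun y => ell x <= ell y) s.
  by apply: order_path_min pxs => a b c; apply: leq_trans.
have {}IHs := IHs (path_sorted pxs).
have [xJ|Jx|xJ] := ltngtP (ell x) J.
- by rewrite ltnS (ltnW xJ) /= IHs.
- by rewrite ltnNge Jx /= IHs.
- rewrite xJ ltnS leqnn -IHs.
  suff -> : [seq i <- s | ell i < J] = [::] by [].
  apply/eqP; rewrite -[_ == _]negbK -has_filter -all_predC.
  by apply: sub_all sle => y /=; rewrite xJ -leqNgt.
Qed.

Lemma red_word_cat n u v : red_word n (u ++ v) = red_word n u ++ red_word n v.
Proof. by rewrite /red_word map_cat flatten_cat. Qed.

Lemma red_word_flatten n (T : Type) (f : T -> seq nat) (s : seq T) :
  red_word n (flatten [seq f j | j <- s]) = flatten [seq red_word n (f j) | j <- s].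
Proof. by elim: s => //= x s IHs; rewrite red_word_cat IHs. Qed.

Lemma reds_diagram n (Y : boxes n) : 0 < n -> is_young Y ->
  reds (diagram Y) = red_word n (rev (iota 1 n.-1)).
Proof.
move=> n0 yY; rewrite /diagram reds_cat reds_flatten -map_comp.
have -> : [seq (reds \o (fun j => blue_block n j ++ gap Y j)) i | i <- iota 1 n.-1] =
          [seq reds (gap Y j) | j <- iota 1 n.-1].
  by apply: eq_map => j /=; rewrite reds_cat reds_blue_block.
have -> : reds (gap Y 0) ++ flatten [seq reds (gap Y j) | j <- iota 1 n.-1] =
          flatten [seq reds (gap Y j) | j <- iota 0 n] by case: (n) n0 Y {yY}.
rewrite (eq_map (reds_gap Y)) -red_word_flatten flatten_filter_fibres.
  by rewrite (eq_filter (a2 := predT)) ?filter_predT // => i; rewrite /= row_length_lt.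
rewrite rev_sorted.
have pos : all (fun i => 0 < i) (iota 1 n.-1).
  by apply/allP=> i; rewrite mem_iota => /andP[].
apply: (sub_in_sorted _ pos (iota_ltn_sorted 1 n.-1)) => i j i0 _.
by move/ltnW; apply: antitone_pos i0 => h; apply: row_length_anti.
Qed.

Lemma blues_diagram n (Y : boxes n) :
  blues (diagram Y) = flatten [seq iota 1 (n - j) | j <- iota 1 n.-1].
Proof.
rewrite /diagram blues_cat blues_gap /= blues_flatten -map_comp; congr flatten.
by apply: eq_map => j /=; rewrite blues_cat blues_gap cats0 blues_blue_block.
Qed.

(** Block [b_j] crosses track [t] iff [j <= n - t], whence the minimum. *)
Lemma admissible_blue_word n J : J <= n.-1 ->
  let w := flatten [seq iota 1 (n - j) | j <- iota 1 J] in
  admissible_from [::] w /\ forall t, 0 < t -> count_mem t w = minn J (n - t).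
Proof.
elim: J => [|J IHJ] Jn; first by split=> // t; rewrite min0n.
have [//|adm cw] := IHJ; first exact: ltnW.
rewrite iota1S map_cat flatten_cat /= cats0; set w := flatten _ in adm cw *.
rewrite admissible_from_cat adm /=; split=> [|t t0]; last first.
  by rewrite count_cat count_mem_iota cw //; lia.
by apply: admissible_from_iota => // h h1; rewrite !cw //; lia.
Qed.

(** The blocks are [r_i] for [n - J <= i < n], by decreasing [i]; those crossing track [t] have
    [i <= n - t]. *)
Lemma admissible_red_word n J : J <= n.-1 ->
  let w := red_word n (rev (iota (n - J) J)) in
  admissible_from [::] w /\ forall t, 0 < t -> count_mem t w = J.+1 - t.
Proof.
rewrite /red_word; elim: J => [|J IHJ] Jn /=; first by split=> // t; lia.
have [|adm cw] := IHJ; first exact: ltnW.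
have -> : rev (n - J.+1 :: iota (n - J.+1).+1 J) = rev (iota (n - J) J) ++ [:: n - J.+1].
  by rewrite rev_cons -cats1; congr (rev (iota _ _) ++ _); lia.
rewrite map_cat flatten_cat /= cats0; set w := flatten _ in adm cw *.
rewrite admissible_from_cat adm /=; split=> [|t t0]; last first.
  by rewrite count_cat count_rev count_mem_iota cw //; lia.
have -> : n - (n - J.+1) = J.+1 by lia.
by apply: admissible_from_rev_iota => [|h h1]; rewrite !cw //; lia.
Qed.

(** * Crossings counted in prefixes of D(Y) *)

Lemma count_iota_interval a N m : 0 < a -> N <= m ->
  count (fun i => a <= i <= N) (iota 1 m) = N.+1 - a.
Proof.
move=> a0 Nm; rewrite -(subnKC Nm); move: (m - N) => d {m Nm}.
rewrite iotaD count_cat [X in _ + X](_ : _ = 0) ?addn0; last first.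
  apply/eqP; rewrite -leqn0 leqNgt -has_count; apply/hasPn => i.
  by rewrite mem_iota; lia.
elim: N => [|N IHN]; first by case: a a0.
rewrite iota1S count_cat /= -(@eq_in_count _ (fun i => a <= i <= N)) => [|i]; last first.
  by rewrite mem_iota; lia.
by rewrite IHN; lia.
Qed.

(* The number of crossings in track t among the red blocks inserted before b_j
   (1-based). *)
Definition reds_before (n : nat) (ell : nat -> nat) (t j : nat) : nat :=
  count (fun i => (i + t <= n) && (ell i < j)) (iota 1 n.-1).

Lemma reds_before0 n ell t : reds_before n ell t 0 = 0.
Proof. by rewrite /reds_before; elim: (iota _ _) => //= i s ->; rewrite andbF. Qed.

Lemma reds_before_mono n ell t j j' : j <= j' ->
  reds_before n ell t j <= reds_before n ell t j'.
Proof. by move=> jj'; apply: sub_count => i /=; lia. Qed.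

Lemma count_red_word n t s : 0 < t ->
  count_mem t (red_word n s) = count (fun i => i + t <= n) s.
Proof.
move=> t0; rewrite /red_word; elim: s => //= i s IHs.
by rewrite count_cat IHs count_rev count_mem_iota; congr (nat_of_bool _ + _); lia.
Qed.

Lemma reds_beforeS n (Y : boxes n) t j : 0 < t ->
  reds_before n (row_length Y) t j.+1 =
    reds_before n (row_length Y) t j + count_mem t (reds (gap Y j)).
Proof.
move=> t0; rewrite reds_gap count_red_word // count_filter count_rev /reds_before.
elim: (iota _ _) => //= i s ->; case: (_ <= n) => //=; rewrite ?andbF; lia.
Qed.

(** Truncation of D(Y) after gap [J], for induction; the whole word is the case [J = n.-1]. *)
Definition diagram_upto n (Y : boxes n) J : seq letter :=
  gap Y 0 ++ flatten [seq blue_block n j ++ gap Y j | j <- iota 1 J].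

Lemma diagram_uptoS n (Y : boxes n) J :
  diagram_upto Y J.+1 = diagram_upto Y J ++ blue_block n J.+1 ++ gap Y J.+1.
Proof.
by rewrite /diagram_upto iota1S map_cat flatten_cat /= cats0 !catA.
Qed.

Lemma count_diagram_upto n (Y : boxes n) t J : 0 < t -> J <= n.-1 ->
  count_mem t (reds (diagram_upto Y J)) = reds_before n (row_length Y) t J.+1 /\
  count_mem t (blues (diagram_upto Y J)) = minn J (n - t).
Proof.
move=> t0; elim: J => [|J IHJ] Jn.
  rewrite /diagram_upto /= cats0 blues_gap min0n; split=> //.
  by rewrite reds_beforeS // reds_before0.
have [|rJ bJ] := IHJ; first exact: ltnW.
rewrite diagram_uptoS (reds_cat (diagram_upto _ _)) (blues_cat (diagram_upto _ _)).
rewrite !count_cat rJ bJ reds_cat blues_cat !count_cat.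
rewrite reds_blue_block blues_blue_block blues_gap count_mem_iota (reds_beforeS _ J.+1) //=.
by split; lia.
Qed.

Lemma count_reds_take t p w : count_mem t (reds (take p w)) <= count_mem t (reds w).
Proof. by rewrite -{2}(cat_take_drop p w) reds_cat count_cat leq_addr. Qed.

Lemma count_blues_take t p w : count_mem t (blues (take p w)) <= count_mem t (blues w).
Proof. by rewrite -{2}(cat_take_drop p w) blues_cat count_cat leq_addr. Qed.

(** A prefix with [B > 0] blue crossings in track [t] reaches into [b_B], so it contains every
    earlier gap; it stops before the letter [f_t] of [b_{B+1}], if there is one, so it meets no gap
    beyond gap [B]. *)
Lemma prefix_counts n (Y : boxes n) t J p : 0 < t -> J <= n.-1 ->
  let A := count_mem t (reds (take p (diagram_upto Y J))) in
  let B := count_mem t (blues (take p (diagram_upto Y J))) in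
  reds_before n (row_length Y) t B <= A /\
  (n - t <= B \/ A <= reds_before n (row_length Y) t B.+1).
Proof.
move=> t0; set L := reds_before n (row_length Y) t.
have Lmono i j : i <= j -> L i <= L j by apply: reds_before_mono.
elim: J p => [|J IHJ] p Jn.
  have [r0 b0] := count_diagram_upto Y t0 Jn.
  have /= := count_blues_take t p (diagram_upto Y 0); rewrite b0 min0n leqn0 => /eqP ->.
  by split; [rewrite /L reds_before0 | right; rewrite /L -r0 count_reds_take].
have [rJ bJ] := count_diagram_upto Y t0 (ltnW Jn).
(* The prefix ends before [b_{J+1}], inside it, or in the gap that follows. *)
rewrite diagram_uptoS take_cat; case: ifP => _; first exact: IHJ (ltnW Jn).
rewrite /= take_cat; case: ifP => _;
  rewrite (reds_cat (diagram_upto _ _)) (blues_cat (diagram_upto _ _)) !count_cat rJ bJ.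
  have := count_reds_take t (p - size (diagram_upto Y J)) (blue_block n J.+1).
  have := count_blues_take t (p - size (diagram_upto Y J)) (blue_block n J.+1).
  rewrite reds_blue_block blues_blue_block count_mem_iota /= leqn0.
  set c := count_mem t _ => le_c /eqP ->; rewrite addn0.
  split; first by apply: Lmono; lia.
  have [NJ|JN] := leqP (n - t) J; [left | right]; first by lia.
  by apply: Lmono; lia.
set q := p - _ - _; rewrite reds_cat blues_cat !count_cat.
have := count_reds_take t q (gap Y J.+1); have := count_blues_take t q (gap Y J.+1).
rewrite reds_blue_block blues_blue_block blues_gap count_mem_iota /= leqn0.
set c := count_mem t _ => /eqP ->; set d := count_mem t _; rewrite !addn0 add0n.
have LS : L J.+2 = L J.+1 + count_mem t (reds (gap Y J.+1)) by apply: reds_beforeS.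
move=> le_c; have -> : minn J (n - t) + (0 < t < 1 + (n - J.+1)) = minn J.+1 (n - t) by lia.
split; first by apply: leq_trans (leq_addr _ _); apply: Lmono; lia.
have [NJ|JN] := leqP (n - t) J.+1; [left | right]; first by lia.
by rewrite LS leq_add2l.
Qed.

(** As row lengths decrease weakly, the rows up to [N = n - t] shorter than a bound are the last
    ones. So, away from the borders of the square, [prefix_counts] says that row [N - A] has at
    least [B] boxes and row [(N - A).+1] at most [B]. *)
Lemma path_of_prefix n (Y : boxes n) t p : is_young Y -> 0 < t <= n ->
  let w := take p (diagram Y) in
  [/\ count_mem t (reds w) + t <= n, count_mem t (blues w) + t <= n &
   on_path n (row_length Y) t (n - t - count_mem t (reds w)) (count_mem t (blues w))].
Proof.
move=> yY /andP[t0 tn] /=.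
have n0 : 0 < n by apply: leq_trans tn.
have [rw bw] := count_diagram_upto Y t0 (leqnn n.-1).
have [] := prefix_counts Y p t0 (leqnn n.-1).
have := count_reds_take t p (diagram Y); have := count_blues_take t p (diagram Y).
rewrite -/(diagram Y) in rw bw *; rewrite rw bw.
set A := count_mem t (reds (take p _)); set B := count_mem t (blues (take p _)).
set ell := row_length Y.
have ell_anti i j : 0 < i -> i <= j -> ell j <= ell i.
  by apply: antitone_pos => h; apply: row_length_anti.
set N := n - t => le_B le_A [le_LB le_AL].
have LN : reds_before n ell t n.-1.+1 <= N.
  have <- : count (fun i => 1 <= i <= N) (iota 1 n.-1) = N.
    by rewrite count_iota_interval ?subn1 //; lia.
  (* [sub_count] compares predicates on all of [nat], so positivity of the row number is first
     inserted. *)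
  rewrite /reds_before -(@eq_in_count _
    (fun i => (0 < i) && ((i + t <= n) && (ell i < n.-1.+1)))).
    by apply: sub_count => i /=; lia.
  by move=> i; rewrite mem_iota => /andP[-> _].
split; first (by lia); first by lia.
apply/and4P; split; [by lia | by lia | |].
  have [//|A_N] := eqVneq (N - A) 0; have [//|B_0] := eqVneq B 0.
  rewrite /= leqNgt; apply/negP => lt_ell.
  (* Otherwise rows [N - A] to [N], one more than [A], are all shorter than [B]. *)
  suff : N.+1 - (N - A) <= reds_before n ell t B by lia.
  rewrite -(@count_iota_interval (N - A) N n.-1); try lia.
  apply: sub_count => i /= /andP[ai iN].
  by have := @ell_anti (N - A) i; lia.
have [//|nA] := eqVneq (N - A + t) n; have [//|nB] := eqVneq (B + t) n.
rewrite /= leqNgt; apply/negP => lt_ell.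
(* Otherwise rows with at most [B] boxes start after row [(N - A).+1], leaving fewer than [A]. *)
suff : reds_before n ell t B.+1 <= N.+1 - (N - A).+2 by lia.
rewrite -(@count_iota_interval (N - A).+2 N n.-1) //; last by lia.
rewrite /reds_before -(@eq_in_count _
  (fun i => (0 < i) && ((i + t <= n) && (ell i < B.+1)))).
  by apply: sub_count => i /=; have := @ell_anti i (N - A).+1; lia.
by move=> i; rewrite mem_iota => /andP[-> _].
Qed.

Lemma count_track t (w : seq letter) :
  count (fun l => track l == t) w = count_mem t (reds w) + count_mem t (blues w).
Proof. by elim: w => //= -[s|s] w -> /=; lia. Qed.

(** The number of letters of track [t] in a prefix grows by steps of at most one; the shortest
    prefix with [v] of them is empty or ends with such a letter, so it marks a chamber. *)
Lemma mem_chambers_count (w : seq letter) t v :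
  v <= count (fun l => track l == t) w ->
  exists2 p, p \in chambers w t & count (fun l => track l == t) (take p w) = v.
Proof.
set P := fun l => _ => vw.
have ex : exists p, v <= count P (take p w) by exists (size w); rewrite take_size.
case: (ex_minnP ex) => -[|p] vp pmin.
  by exists 0; rewrite ?inE // take0 /= in vp *; lia.
have lt_p : p < size w.
  rewrite ltnNge; apply/negP => wp; have := pmin p.
  by rewrite take_oversize // vw => /(_ isT); rewrite ltnn.
have v0 : count P (take p w) < v.
  by rewrite ltnNge; apply/negP => /pmin; rewrite ltnn.
move: vp; rewrite (take_nth (red_cross 0)) // -cats1 count_cat /= addn0 => vp.
exists p.+1; last first.
  rewrite (take_nth (red_cross 0)) // -cats1 count_cat /= addn0.
  by move: vp; case: (P _) => /=; lia.
rewrite inE /= map_f // mem_filter mem_iota add0n lt_p andbT.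
rewrite (nth_map (red_cross 0)) //.
by rewrite leq0n andbT -[_ == t]/(P _); move: vp; case: (P _) => //=; lia.
Qed.

(** For [a < a'] on one diagonal, the outer condition at the first corner gives [ell a.+1 <= b], the
    inner one at the second [b < b' <= ell a'], against monotonicity. *)
Lemma on_path_uniq n ell t a b a' b' :
  (forall i, 0 < i -> ell i.+1 <= ell i) ->
  on_path n ell t a b -> on_path n ell t a' b' -> a + b' = a' + b -> a = a' /\ b = b'.
Proof.
move=> /antitone_pos ell_anti.
wlog aa' : a b a' b' / a <= a' => [Hw pab pab' e|].
  have [aa'|/ltnW aa'] := leqP a a'; first exact: Hw.
  by have [//|-> ->] := Hw _ _ _ _ aa' pab' pab.
rewrite /on_path => /and4P[_ _ _ out] /and4P[atn btn inn _] e.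
have [eaa'|naa'] := eqVneq a a'; first by split=> //; lia.
have lt_aa' : a < a' by lia.
by have := ell_anti _ _ (ltn0Sn a) lt_aa'; lia.
Qed.

(** Start where the diagonal enters the square, with a zero coordinate since [minn x y = t.-1], and
    stop at the first corner satisfying [outer]; failure of [outer] one step before yields the inner
    condition. *)
Lemma on_path_ex n ell t x y : 0 < t -> x < n -> y < n -> minn x y = t.-1 ->
  exists a b, on_path n ell t a b /\ a + y = b + x.
Proof.
move=> t0 xn yn xyt; pose a c := x - t.-1 + c; pose b c := y - t.-1 + c.
pose outer c := [|| a c + t >= n, b c + t >= n | ell (a c).+1 <= b c].
have ex : exists c, outer c.
  by exists n; rewrite /outer /a; lia.
case: (ex_minnP ex) => c outc cmin.
exists (a c), (b c); split; last by rewrite /a /b; lia.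
have prev : c = 0 \/ 0 < c /\ ~~ outer c.-1.
  case: (c) cmin => [|c'] cmin; [by left | right; split=> //].
  by apply/negP => /cmin; rewrite ltnn.
move: prev outc; rewrite /outer /a /b {ex cmin outer}.
case: c => [|c] /= prev outc; rewrite /on_path.
  by rewrite !addn0 in outc *; lia.
case: prev => [//|[_]]; rewrite !negb_or -!ltnNge => /and3P[ac bc lc].
by rewrite !addnS in outc *; lia.
Qed.

(** * The test set as a set of solid minors, and its size *)

Section TestMinors.

Variables (n k : nat) (Y : boxes n).
Hypotheses (n0 : 0 < n) (kn : 0 < k <= n) (yY : is_young Y).

Let ell := row_length Y.

Lemma chamber_minor_prefix t p : 0 < t <= n ->
  let w := take p (diagram Y) in
  chamber_minor n (diagram Y) t p =
    (Defs.interval n t (n - t - count_mem t (reds w)),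
     Defs.interval n t (count_mem t (blues w))).
Proof.
move=> tn /=; have t0 : 0 < t by case/andP: tn.
have [An Bn _] := path_of_prefix p yY tn.
rewrite /chamber_minor /wires_at foldl_cross /=.
(* A prefix of D(Y) restricts to a prefix of each colour, and prefixes of admissible words are
   admissible. *)
have adm_take (f : seq letter -> seq nat) :
    (forall u v, f (u ++ v) = f u ++ f v) ->
    admissible_from [::] (f (diagram Y)) ->
    admissible_from [::] (f (take p (diagram Y))).
  move=> fcat; rewrite -{1}(cat_take_drop p (diagram Y)) fcat.
  by rewrite admissible_from_cat => /andP[].
rewrite (@labels_upto_red n t) //; last first.
  apply: adm_take; first exact: reds_cat.
  rewrite reds_diagram //; have [] := @admissible_red_word n n.-1 (leqnn _).
  by have -> : n - n.-1 = 1 by lia.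
rewrite -[fun h => h]/(@id nat) labels_upto_blue //.
apply: adm_take; first exact: blues_cat.
by rewrite blues_diagram; have [] := @admissible_blue_word n n.-1 (leqnn _).
Qed.

Definition solid (t a b : nat) : minor_index n :=
  (Defs.interval n t a, Defs.interval n t b).

Lemma chamber_minorsP IJ :
  reflect (exists t a b, [/\ 0 < t <= k, on_path n ell t a b & IJ = solid t a b])
          (IJ \in chamber_minors n k (diagram Y)).
Proof.
rewrite inE; apply: (iffP allpairsPdep) => [[t [p [tk pch ->]]]|[t [a [b [tk pab ->]]]]].
  have tk' : 0 < t <= k by move: tk; rewrite mem_iota; lia.
  have tn : 0 < t <= n by lia.
  rewrite chamber_minor_prefix //; have [_ _ pth] := path_of_prefix p yY tn.
  by do 3!eexists; split; [exact: tk' | exact: pth | ].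
have tn : 0 < t <= n by lia.
have t0 : 0 < t by lia.
case/and4P: (pab) => atn btn _ _.
(* After A red and B blue crossings the corner is [a = n - t - A], [b = B], so [n - t - a + b] is
   the number A + B of crossings so far; it fixes the diagonal, hence the corner. *)
have [p pch cp] : exists2 p, p \in chambers (diagram Y) t &
    count (fun l => track l == t) (take p (diagram Y)) = n - t - a + b.
  apply: mem_chambers_count; rewrite count_track reds_diagram // blues_diagram.
  have [_ ->] := @admissible_blue_word n n.-1 (leqnn _) => //.
  have := @admissible_red_word n n.-1 (leqnn _).
  have -> : n - n.-1 = 1 by lia.
  by case=> _ /(_ t t0) /= ->; lia.
exists t, p; split=> //; first by rewrite mem_iota; lia.
rewrite chamber_minor_prefix //; have [An Bn pth] := path_of_prefix p yY tn.
move: cp; rewrite count_track => cp.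
have [|-> ->] // := on_path_uniq (fun i => @row_length_anti n Y i yY) pab pth.
by rewrite -/ell; lia.
Qed.

Lemma solid_minorsP IJ :
  reflect (exists a b, [/\ a + k <= n, b + k <= n & IJ = solid k a b])
          (IJ \in solid_minors n k).
Proof.
apply: (iffP imset2P) => [[i j _ _ ->]|[a [b [an bn ->]]]].
  exists i, j; split=> //; have := ltn_ord i; have := ltn_ord j; lia.
have a_lt : a < (n - k).+1 by lia.
have b_lt : b < (n - k).+1 by lia.
by exists (Ordinal a_lt) (Ordinal b_lt).
Qed.

Lemma solid_inj t a b t' a' b' : 0 < t -> a + t <= n -> b + t <= n ->
  a' + t' <= n -> b' + t' <= n -> solid t a b = solid t' a' b' ->
  [/\ t = t', a = a' & b = b'].
Proof.
move=> t0 an bn an' bn' [eI eJ].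
have [et ea] := interval_inj t0 an an' eI.
by have [_ eb] := interval_inj t0 bn bn' eJ.
Qed.

(* Bijection with an n x n grid: the minors of track t < k correspond, via
   their diagonal a - b, to the cells (x, y) with min(x, y) + 1 = t; the solid
   k-minors fill the remaining square. *)
Definition cell_minor (xy : 'I_n * 'I_n) (IJ : minor_index n) : Prop :=
  exists t a b, IJ = solid t a b /\
    if (minn xy.1 xy.2).+1 < k
    then [/\ t = (minn xy.1 xy.2).+1, a + xy.2 = b + xy.1 & on_path n ell t a b]
    else [/\ t = k, a + k.-1 = xy.1 & b + k.-1 = xy.2].

Lemma card_test_minors : #|test_minors k Y| = n ^ 2.
Proof.
have ell_anti i : 0 < i -> ell i.+1 <= ell i by apply: row_length_anti.
have [g gP] : exists g : 'I_n * 'I_n -> minor_index n, forall xy, cell_minor xy (g xy).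
  apply: fin_all_exists => -[x y]; rewrite /cell_minor /=.
  have [xyk|kxy] := ltnP (minn x y).+1 k.
    have [a [b [pab e]]] :=
      @on_path_ex n ell (minn x y).+1 x y isT (ltn_ord x) (ltn_ord y) erefl.
    by exists (solid (minn x y).+1 a b), (minn x y).+1, a, b.
  exists (solid k (x - k.-1) (y - k.-1)), k, (x - k.-1), (y - k.-1); split=> //.
  by split=> //; lia.
(* [x] and [y] are recovered from their minimum [t.-1] and the difference [a - b], or from the
   corner when the order is [k]. *)
have g_inj : injective g.
  move=> [x y] [x' y'] eg.
  have [t [a [b [e1 H1]]]] := gP (x, y); have [t' [a' [b' [e2 H2]]]] := gP (x', y').
  move: eg; rewrite e1 e2 => es.
  have bounds (u v : 'I_n) s c d :
      (if (minn u v).+1 < k then [/\ s = (minn u v).+1, c + v = d + u & on_path n ell s c d]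
       else [/\ s = k, c + k.-1 = u & d + k.-1 = v]) ->
      [/\ 0 < s, c + s <= n & d + s <= n].
    have := ltn_ord u; have := ltn_ord v; case: ifP => _ vn un [-> e p].
      by case/and4P: p; split.
    by split; lia.
  have [t0 an bn] := bounds _ _ _ _ _ H1; have [_ an' bn'] := bounds _ _ _ _ _ H2.
  have [? ? ?] := solid_inj t0 an bn an' bn' es; subst t' a' b'.
  move: H1 H2 => /=; case: ifP => xyk; case: ifP => xyk' [? ? ?] [? ? ?];
    congr (_, _); apply: val_inj => /=; lia.
have -> : n ^ 2 = #|{: 'I_n * 'I_n}| by rewrite card_prod card_ord mulnn.
rewrite -cardsT -(card_imset _ g_inj); apply: eq_card => IJ.
have g_solid (x y : 'I_n) a b : a + k.-1 = x -> b + k.-1 = y -> solid k a b = g (x, y).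
  move=> ax bx; have [t [a' [b' [-> /=]]]] := gP (x, y).
  by rewrite ifF => [[-> ea eb]|]; [congr solid|]; lia.
have kmem a b : a + k <= n -> b + k <= n -> exists2 xy, xy \in setT & solid k a b = g xy.
  move=> an bn; have xn : a + k.-1 < n by lia.
  have yn : b + k.-1 < n by lia.
  by exists (Ordinal xn, Ordinal yn); rewrite ?inE //; apply: g_solid.
rewrite [in LHS]inE; apply/orP/imsetP => [[/chamber_minorsP|/solid_minorsP]|[[x y] _ ->]].
- case=> t [a [b [tk pab ->]]]; case/and4P: (pab) => an bn _ _.
  (* Chamber minors of track [k] are solid k-minors, so they belong to the second kind of cell. *)
  have [etk|ntk] := eqVneq t k; first by rewrite etk in an bn *; apply: kmem.
  (* Truncated subtraction gives these two coordinates the minimum [t.-1] and the same difference as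
     [a] and [b]. *)
  have xn : t.-1 + (a - b) < n by lia.
  have yn : t.-1 + (b - a) < n by lia.
  exists (Ordinal xn, Ordinal yn); rewrite ?inE //.
  have [t' [a' [b' [-> /=]]]] := gP (Ordinal xn, Ordinal yn).
  have -> : (minn (t.-1 + (a - b)) (t.-1 + (b - a))).+1 = t by lia.
  rewrite ifT; last by lia.
  case=> -> e pab'; have [|-> ->] // := on_path_uniq ell_anti pab pab'; lia.
- by case=> a [b [an bn ->]]; apply: kmem.
- have [t [a [b [-> H]]]] := gP (x, y).
  move: H (ltn_ord x) (ltn_ord y) => /=; case: ifP => xyk [-> ea eb] xn yn.
    by left; apply/chamber_minorsP; do 3!eexists; split; [ | exact: eb | ] => //; lia.
  right; apply/solid_minorsP; exists a, b; split=> //; lia.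
Qed.

End TestMinors.

Local Open Scope ring_scope.

Lemma test_minors_k_positive (R : realType) (n k : nat) (Y : boxes n) (M : 'M[R]_n) :
  (0 < k <= n)%N -> is_young Y ->
  k_positive k M <-> (forall IJ, IJ \in test_minors k Y -> 0 < minor M IJ).
Proof.
case: n Y M => [|n] Y M kn yY; first by lia.
split=> [Mpos IJ|Tpos].
  have solidP t a b : (0 < t <= k)%N -> (a + t <= n.+1)%N -> (b + t <= n.+1)%N ->
      0 < minor M (solid n.+1 t a b).
    by move=> tk an bn; apply: Mpos; rewrite !card_interval.
  rewrite inE => /orP[/chamber_minorsP -/(_ isT kn yY)|/solid_minorsP -/(_ isT kn)].
    by case=> t [a [b [tk /and4P[an bn _ _] ->]]]; apply: solidP.
  by case=> a [b [an bn ->]]; apply: solidP => //; lia.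
apply/solid_pos_k_positive/(solid_pos_of_path (ell := row_length Y)).
- by move=> i; apply: row_length_anti.
- move=> a b an bn; rewrite -minor_solid //; apply: Tpos.
  by rewrite inE; apply/orP; right; apply/solid_minorsP => //; exists a, b.
- move=> t a b tk pab; case/and4P: (pab) => an bn _ _.
  rewrite -minor_solid //; apply: Tpos.
  by rewrite inE; apply/orP; left; apply/chamber_minorsP => //; exists t, a, b.
Qed.

Theorem theorem5p11 (R : realType) (n k : nat) (Y : nat -> boxes n) :
  (2 <= n)%N -> (1 <= k <= n)%N ->
  Y 0%N = set0 ->
  Y (n.-1 ^ 2)%N = [set: 'I_n.-1 * 'I_n.-1] ->
  (forall m : nat, (m <= n.-1 ^ 2)%N -> is_young (Y m)) ->
  (forall m : nat, (m < n.-1 ^ 2)%N -> adds_one_box (Y m) (Y m.+1)) ->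
  forall m : nat, (m <= n.-1 ^ 2)%N ->
    #|test_minors k (Y m)| = (n ^ 2)%N /\
    forall M : 'M[R]_n,
      k_positive k M <->
      (forall IJ : minor_index n, IJ \in test_minors k (Y m) -> 0 < minor M IJ).
Proof.
move=> n2 kn _ _ yY _ m mn; split=> [|M].
  by apply: card_test_minors => //; [apply: ltnW | apply: yY].
by apply: test_minors_k_positive => //; apply: yY.
Qed.
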